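(* Let $(M,g,f)=(M^n,g(\tau),f(\cdot,\tau))_{\tau>0}$ be a complete gradient shrinking Ricci soliton whose potential $f$ comes from the conjugate heat kernel $u=(4\pi\tau)^{-n/2}e^{-f}$. Then $u$ satisfies $$|\nabla \log u|^{2}-\partial_\tau \log u=\frac{n}{2\tau}$$ on $M$ for all $\tau>0$.
   Context: Setting. $M$ is a smooth manifold of dimension $n$ (compact or non-compact), $\tau>0$ is backward time, and $g(\tau)$ is a smooth family of complete Riemannian metrics on $M$ with $\partial_\tau g=2\,\mathrm{Ric}$. The gradient, Laplacian, norms, Ricci curvature $\mathrm{Ric}$ and scalar curvature $\mathrm{R}$ are those of $g(\tau)$. The conjugate heat kernel is the (non-constant) positive fundamental solution $u$ of the conjugate heat equation $\partial_\tau u=\Delta u-\mathrm{R}\,u$, written $u=(4\pi\tau)^{-n/2}e^{-f}$, which defines $f$. ''$(M,g,f)$ is a shrinking Ricci soliton'' means that, with this $f$, $$\mathrm{Ric}+\nabla^2 f=\frac{g}{2\tau}\quad\text{for all }\tau>0.$$ *)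

(* Defs.v *)
From HB Require Import structures.
From mathcomp Require Import all_boot all_order all_algebra.
From mathcomp Require Import all_classical all_reals all_analysis.

Set Implicit Arguments.
Unset Strict Implicit.
Unset Printing Implicit Defensive.

Import Order.TTheory GRing.Theory Num.Theory.
Import numFieldNormedType.Exports.

Local Open Scope classical_set_scope.
Local Open Scope ring_scope.

(* [Ck k A F]: F is of class C^k at the points of A.  It is only used with A
   open in a finite-dimensional space, where continuity of all iterated
   directional derivatives of order at most k is the usual C^k condition. *)
Fixpoint Ck (R : numFieldType) (V W : normedModType R) (k : nat)
    (A : set V) (F : V -> W) : Prop :=
  (forall x, A x -> {for x, continuous F}) /\
  match k with
  | 0 => True
  | k'.+1 => forall v : V,
      (forall x, A x -> derivable F x v) /\ Ck k' A (fun x => 'D_v F x)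
  end.

Definition smooth_on (R : numFieldType) (V W : normedModType R)
    (A : set V) (F : V -> W) : Prop := forall k, Ck k A F.

(* A smooth n-manifold, possibly compact, given by a smooth atlas.  The chart
   [c] is the homeomorphism [phi c] from the open set [dom c] onto the open set
   [phi c @` dom c], with inverse [psi c]; both maps are total functions whose
   values outside these sets are irrelevant. *)
Record smooth_manifold (R : realType) (n : nat) := SmoothManifold {
  carrier :> ptopologicalType;
  manifold_hausdorff : hausdorff_space carrier;
  manifold_second_countable : @second_countable carrier;
  chart : Type;
  dom : chart -> set carrier;
  phi : chart -> carrier -> 'rV[R]_n;
  psi : chart -> 'rV[R]_n -> carrier;
  dom_cover : forall p, exists c, dom c p;
  dom_open : forall c, open (dom c);
  cod_open : forall c, open (phi c @` dom c);
  phiK : forall c p, dom c p -> psi c (phi c p) = p;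
  phi_continuous : forall c p, dom c p -> {for p, continuous (phi c)};
  psi_continuous : forall c x, (phi c @` dom c) x -> {for x, continuous (psi c)};
  transition_smooth : forall c d,
    smooth_on (phi c @` (dom c `&` dom d)) (phi d \o psi c) }.

Arguments chart {R n} M : rename.
Arguments dom {R n M} c _ : rename.
Arguments phi {R n M} c _ : rename.
Arguments psi {R n M} c _ : rename.

(* The components of a covariant 2-tensor field in each chart, as functions of
   the coordinates. *)
Definition tensor2 (R : realType) (n : nat) (M : smooth_manifold R n) :=
  chart M -> 'rV[R]_n -> 'M[R]_n.

(* Local formulas in one chart: [G x] is the matrix g_ij of the metric at the
   point with coordinates x, and h is a function of the coordinates. *)
Section LocalFormulas.
Variables (R : realType) (n : nat) (G : 'rV[R]_n -> 'M[R]_n).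
Implicit Types (h : 'rV[R]_n -> R) (x : 'rV[R]_n) (i j k l m : 'I_n).

Definition partial i h x : R := 'D_(delta_mx 0 i) h x.

Definition norm2 x (v : 'rV[R]_n) : R := (v *m G x *m v^T) 0 0.

Definition gradient h x : 'rV[R]_n := (\row_j partial j h x) *m invmx (G x).

(* Gamma^k_ij of the Levi-Civita connection *)
Definition christoffel k i j x : R :=
  2^-1 * \sum_l invmx (G x) k l *
    (partial i (fun y => G y j l) x + partial j (fun y => G y i l) x
     - partial l (fun y => G y i j) x).

Definition hessian h x : 'M[R]_n :=
  \matrix_(i, j) (partial i (partial j h) x
                  - \sum_k christoffel k i j x * partial k h x).

Definition laplacian h x : R := \tr (invmx (G x) *m hessian h x).

(* The l-th component of R(d_i, d_j) d_k, with the convention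
   R(X, Y) Z = nabla_X nabla_Y Z - nabla_Y nabla_X Z - nabla_[X, Y] Z. *)
Definition riemann i j k l x : R :=
  partial i (christoffel l j k) x - partial j (christoffel l i k) x
  + \sum_m (christoffel m j k x * christoffel l i m x
            - christoffel m i k x * christoffel l j m x).

(* Ric(Y, Z) is the trace of X |-> R(X, Y) Z *)
Definition ricci x : 'M[R]_n := \matrix_(j, k) \sum_i riemann i j k i x.

Definition scalar_curvature x : R := \tr (invmx (G x) *m ricci x).

End LocalFormulas.

Definition riemannian (R : realType) (n : nat) (M : smooth_manifold R n)
    (g : tensor2 M) : Prop :=
  [/\ (forall c x, (phi c @` dom c) x -> (g c x)^T = g c x),
      (forall c x (v : 'rV[R]_n), (phi c @` dom c) x -> v != 0 ->
         0 < norm2 (g c) x v),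
      (forall c, smooth_on (phi c @` dom c) (g c)) &
      (* the components transform as those of a covariant 2-tensor *)
      (forall c d p (v w : 'rV[R]_n), dom c p -> dom d p ->
         (v *m g c (phi c p) *m w^T) 0 0
         = ('D_v (phi d \o psi c) (phi c p) *m g d (phi d p)
            *m ('D_w (phi d \o psi c) (phi c p))^T) 0 0)].

Section Completeness.
Variables (R : realType) (n : nat) (M : smooth_manifold R n) (g : tensor2 M).

(* Velocities may vanish, so any piecewise C^1 path on [0, 1] is, up to
   reparametrization, the restriction of such a curve. *)
Definition C1_curve (gam : R -> M) : Prop :=
  continuous gam /\
  forall c : chart M, Ck 1 (gam @^-1` dom c) (phi c \o gam).

Definition has_speed (gam : R -> M) (s : R -> R) : Prop :=
  forall t c, dom c (gam t) ->
    s t = Num.sqrt (norm2 (g c) (phi c (gam t)) (derive1 (phi c \o gam) t)).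

(* +oo when p and q are not joined by any curve *)
Definition riemannian_dist (p q : M) : \bar R :=
  ereal_inf [set l | exists gam s,
    [/\ C1_curve gam, gam 0 = p, gam 1 = q, has_speed gam s &
        l = (\int[lebesgue_measure]_(t in `[0%R, 1%R]) (s t)%:E)%E]].

Definition complete_metric : Prop :=
  forall x : nat -> M,
    (forall e : R, 0 < e -> exists N : nat, forall i j : nat,
       (N <= i)%N -> (N <= j)%N -> (riemannian_dist (x i) (x j) < e%:E)%E) ->
    exists p, riemannian_dist (x i) p @[i --> \oo] --> 0%E.

End Completeness.

(* The Lebesgue integral over R^n of a nonnegative Borel function, as an
   iterated integral (Tonelli). *)
Fixpoint lebesgue_int (R : realType) (n : nat) :
    ('rV[R]_n -> \bar R) -> \bar R :=
  match n with
  | 0 => fun F => F 0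
  | m.+1 => fun F => (\int[lebesgue_measure]_(t in [set: R])
      lebesgue_int (fun y : 'rV[R]_m => F (row_mx (t%:M : 'rV[R]_1) y)))%E
  end.

Definition borel_type (M : ptopologicalType) :=
  g_sigma_algebraType (@open M).

(* The Borel measure with density sqrt(det g) in every chart; it is unique by
   second countability. *)
Definition riemannian_volume (R : realType) (n : nat) (M : smooth_manifold R n)
    (g : tensor2 M) (vol : {measure set (borel_type M) -> \bar R}) : Prop :=
  forall (c : chart M) (A : set (borel_type M)),
    measurable A -> A `<=` dom c ->
    vol A = lebesgue_int (fun x : 'rV[R]_n =>
              (\1_(phi c @` A) x * Num.sqrt (\det (g c x)))%:E).

Section BackwardFlow.
Variables (R : realType) (n : nat) (M : smooth_manifold R n).
Variable (g : R -> tensor2 M).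

Definition spacetime_cod (c : chart M) : set (R * 'rV[R]_n) :=
  [set z | 0 < z.1 /\ (phi c @` dom c) z.2].

Definition smooth_complete_metrics : Prop :=
  (forall c, smooth_on (spacetime_cod c) (fun z => g z.1 c z.2)) /\
  (forall tau, 0 < tau -> riemannian (g tau) /\ complete_metric (g tau)).

Definition backward_ricci_flow : Prop :=
  forall tau c x i j, 0 < tau -> (phi c @` dom c) x ->
    derive1 (fun s => g s c x i j) tau = 2 * ricci (g tau c) x i j.

Definition smooth_function (u : R -> M -> R) : Prop :=
  forall c, smooth_on (spacetime_cod c) (fun z => u z.1 (psi c z.2)).

Definition conjugate_heat_equation (u : R -> M -> R) : Prop :=
  forall tau p c, 0 < tau -> dom c p ->
    derive1 (u ^~ p) tau
    = laplacian (g tau c) (u tau \o psi c) (phi c p)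
      - scalar_curvature (g tau c) (phi c p) * u tau p.

(* u(., tau) dvol_(g tau) tends to the Dirac mass at p as tau decreases to 0,
   tested against compactly supported continuous functions *)
Definition tends_to_dirac (u : R -> M -> R) (p : M) : Prop :=
  exists2 vol : R -> {measure set (borel_type M) -> \bar R},
    (forall tau, 0 < tau -> riemannian_volume (g tau) (vol tau)) &
    (forall eta : M -> R, continuous eta ->
       compact (closure [set q | eta q != 0]) ->
       (\int[vol tau]_(q in [set: borel_type M]) (eta q * u tau q)%:E)%E
         @[tau --> 0^'+] --> (eta p)%:E).

Definition conjugate_heat_kernel (u : R -> M -> R) : Prop :=
  [/\ smooth_function u,
      (forall tau p, 0 < tau -> 0 < u tau p),
      conjugate_heat_equation u,
      (exists p, tends_to_dirac u p) &
      ~ (exists a, forall tau p, 0 < tau -> u tau p = a)].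

Definition shrinking_soliton (f : R -> M -> R) : Prop :=
  forall tau p c, 0 < tau -> dom c p ->
    ricci (g tau c) (phi c p) + hessian (g tau c) (f tau \o psi c) (phi c p)
    = (2 * tau)^-1 *: g tau c (phi c p).

End BackwardFlow.

(* Main.v *)
(* Put h = log u.  Dividing the conjugate heat equation by u gives
   d_tau h = Delta h + |nabla h|^2 - R, hence
   |nabla h|^2 - d_tau h = R - Delta h.  Since f + h is constant in space, the
   right-hand side is R + Delta f, the trace of the soliton equation, which is
   n / (2 tau). *)
Require Import Defs.
From HB Require Import structures.
From mathcomp Require Import all_boot all_order all_algebra.
From mathcomp Require Import all_classical all_reals all_analysis.

Set Implicit Arguments.
Unset Strict Implicit.
Unset Printing Implicit Defensive.

Import Order.TTheory GRing.Theory Num.Theory.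
Import numFieldNormedType.Exports.

Local Open Scope classical_set_scope.
Local Open Scope ring_scope.

(** A directional derivative is an ordinary derivative at [0] along the line [h *: v + x]. This
    brings in the one-variable chain rule and lets slices of a product be compared as functions of
    [h]. *)
Lemma is_derive_lineP (R : numFieldType) (V W : normedModType R) (F : V -> W)
    (x v : V) (d : W) :
  is_derive x v F d <-> is_derive (0 : R) 1 (fun h => F (h *: v + x)) d.
Proof.
have E : (fun h : R => h^-1 *: ((F \o shift x) (h *: v) - F x))
  = (fun h : R => h^-1 *: (((fun k => F (k *: v + x)) \o shift 0) (h *: 1)
      - F (0 *: v + x))).
  apply/funext => h /=.
  by rewrite scale0r add0r addr0 [h%:A]mulr1.
by split => -[dF <-]; split; rewrite /derivable /derive ?E // -?E.
Qed.

(** Only the derivative along [v] is assumed, so the chain rule is applied to the restriction of [U]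
    to a line. *)
Lemma is_derive_ln_comp (R : realType) (V : normedModType R) (U : V -> R)
    (x v : V) (d : R) :
  0 < U x -> is_derive x v U d ->
  is_derive x v (fun y => ln (U y)) ((U x)^-1 * d).
Proof.
move=> Ux /is_derive_lineP dU; apply/is_derive_lineP.
apply: (@is_derive1_comp R (@ln R) (fun h => U (h *: v + x))) => //.
by rewrite scale0r add0r; exact: is_derive1_ln.
Qed.

Section Slices.
Variables (R : numFieldType) (V1 V2 W : normedModType R).
Variables (H : V1 * V2 -> W) (a : V1) (b : V2).

(** Smoothness of [u] is joint in time and space; this slice freezes time, and the next one freezes
    the point. *)
Lemma is_derive_slicer (v : V2) (d : W) :
  is_derive (a, b) (0, v) H d -> is_derive b v (fun y => H (a, y)) d.
Proof.
move=> /is_derive_lineP dH; apply/is_derive_lineP.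
suff -> : (fun h : R => H (a, h *: v + b))
  = (fun h : R => H (h *: (0, v) + (a, b))) by [].
apply/funext => h; congr (H (_, _)).
by rewrite /= scaler0 add0r.
Qed.

Lemma is_derive_slicel (v : V1) (d : W) :
  is_derive (a, b) (v, 0) H d -> is_derive a v (fun y => H (y, b)) d.
Proof.
move=> /is_derive_lineP dH; apply/is_derive_lineP.
suff -> : (fun h : R => H (h *: v + a, b))
  = (fun h : R => H (h *: (v, 0) + (a, b))) by [].
apply/funext => h; congr (H (_, _)).
by rewrite /= scaler0 add0r.
Qed.

End Slices.

(** A nonzero vector in the kernel of a singular matrix would annihilate the quadratic form. *)
Lemma posdef_unitmx (R : realFieldType) (n : nat) (A : 'M[R]_n) :
  (forall v : 'rV[R]_n, v != 0 -> 0 < (v *m A *m v^T) 0 0) -> A \in unitmx.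
Proof.
move=> Apos; rewrite unitmxE unitfE; apply/negP => /det0P[v v0 vA].
by have := Apos v v0; rewrite vA mul0mx mxE ltxx.
Qed.

Section LocalLaplacian.
Variables (R : realType) (n : nat) (G : 'rV[R]_n -> 'M[R]_n).

Definition differential (h : 'rV[R]_n -> R) (x : 'rV[R]_n) : 'rV[R]_n :=
  \row_j partial j h x.

Lemma norm2_gradient (h : 'rV[R]_n -> R) (x : 'rV[R]_n) :
  G x \in unitmx -> (G x)^T = G x ->
  norm2 G x (gradient G h x)
  = (differential h x *m invmx (G x) *m (differential h x)^T) 0 0.
Proof.
move=> Gu Gs; rewrite /norm2 /gradient -/(differential h x).
by rewrite trmx_mul trmx_inv Gs mulmxKV // mulmxA.
Qed.

Variables (A : set 'rV[R]_n) (U : 'rV[R]_n -> R).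
Hypothesis A_open : open A.
Hypothesis U_gt0 : forall x, A x -> 0 < U x.
Hypothesis dU : forall x i, A x -> derivable U x (delta_mx 0 i).
Hypothesis ddU : forall x i j, A x -> derivable (partial j U) x (delta_mx 0 i).

Lemma partial_ln (x : 'rV[R]_n) i : A x ->
  partial i (fun y => ln (U y)) x = (U x)^-1 * partial i U x.
Proof.
move=> Ax; have dUi := derivableP (@dU x i Ax).
by rewrite /partial; have [_ ->] := is_derive_ln_comp (U_gt0 Ax) dUi.
Qed.

Lemma partial_cstB_ln (a : R) (x : 'rV[R]_n) i : A x ->
  partial i (fun y => a - ln (U y)) x = - ((U x)^-1 * partial i U x).
Proof.
move=> Ax; have dUi := derivableP (@dU x i Ax).
have [dln lnE] := is_derive_ln_comp (U_gt0 Ax) dUi.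
by rewrite /partial (deriveB (derivable_cst a x _) dln) derive_cst sub0r lnE.
Qed.

(** The quotient rule applied to [- partial j U / U] produces the rank-one term. The Christoffel
    part is linear in first derivatives, so it completes [partial i (partial j U)] to
    [hessian G U]. *)
Lemma hessian_cstB_ln (a : R) (x : 'rV[R]_n) : A x ->
  hessian G (fun y => a - ln (U y)) x
  = (U x)^-2 *: ((differential U x)^T *m differential U x)
    - (U x)^-1 *: hessian G U x.
Proof.
move=> Ax; apply/matrixP => i j; rewrite !mxE big_ord1 !mxE.
have Ux0 : U x != 0 by rewrite gt_eqF ?U_gt0.
have -> : partial i (partial j (fun y => a - ln (U y))) x
    = (U x)^-2 * (partial i U x * partial j U x)
      - (U x)^-1 * partial i (partial j U) x.
  (* The formula for the first derivative holds only on [A]; since [A] is open, it holds near [x],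
     which is enough to differentiate it again. *)
  transitivity ('D_(delta_mx 0 i) (- ((fun y => (U y)^-1) * partial j U)) x).
    apply: near_eq_derive; have : \near x, A x by exact: open_nbhs_nbhs.
    by apply: filterS => y Ay; exact: partial_cstB_ln.
  have dV := derivableV Ux0 (@dU x i Ax).
  rewrite deriveN; last by apply: derivableM => //; exact: ddU.
  rewrite deriveM //; last exact: ddU.
  rewrite (deriveV Ux0 (@dU x i Ax)) -!/(partial _ _ _).
  rewrite opprD addrC scaleNr scalerN opprK; congr (_ - _).
  by rewrite [LHS]mulrCA [partial j U x * _]mulrC.
under eq_bigr => k _ do rewrite partial_cstB_ln // mulrN mulrCA.
by rewrite sumrN -mulr_sumr opprK mulrBr opprB addrAC addrA.
Qed.

(** By cyclicity of the trace, the rank-one term of the Hessian becomes the squared norm of the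
    differential of [ln U]. What remains is [laplacian G U] over [U], the term that the conjugate
    heat equation controls. *)
Lemma tr_hessian_cstB_ln (a : R) (x : 'rV[R]_n) :
  G x \in unitmx -> (G x)^T = G x -> A x ->
  \tr (invmx (G x) *m hessian G (fun y => a - ln (U y)) x)
  = norm2 G x (gradient G (fun y => ln (U y)) x)
    - (U x)^-1 * laplacian G U x.
Proof.
move=> Gu Gs Ax; rewrite hessian_cstB_ln // mulmxBr -!scalemxAr raddfB /=.
rewrite !mxtraceZ norm2_gradient //; congr (_ - _).
have -> : differential (fun y => ln (U y)) x = (U x)^-1 *: differential U x.
  by apply/rowP => j; rewrite !mxE partial_ln.
rewrite linearZ /= -!scalemxAl -scalemxAr scalerA mulmxA mxtrace_mulC.
by rewrite mulmxA -exprVn expr2 [in RHS]mxE trace_mx11.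
Qed.

End LocalLaplacian.

Theorem theorem3p1 (R : realType) (n : nat) (M : smooth_manifold R n)
    (g : R -> tensor2 M) (u f : R -> M -> R)
    (g_complete : smooth_complete_metrics g)
    (g_flow : backward_ricci_flow g)
    (u_kernel : conjugate_heat_kernel g u)
    (f_def : forall (tau : R) (p : M), 0 < tau ->
       u tau p = (4 * pi * tau) `^ (- (n%:R / 2)) * expR (- f tau p))
    (g_soliton : shrinking_soliton g f) :
  forall (tau : R) (p : M) (c : chart M), 0 < tau -> dom c p ->
    norm2 (g tau c) (phi c p)
      (gradient (g tau c) ((fun q => ln (u tau q)) \o psi c) (phi c p))
    - derive1 (fun s => ln (u s p)) tau
    = n%:R / (2 * tau).
Proof.
move=> tau p c tau0 cp.
case: u_kernel => u_smooth u_gt0 u_che _ _.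
have [_ /(_ _ tau0)[[g_sym g_pos _ _] _]] := g_complete.
set x := phi c p; set A := phi c @` dom c.
have Ax : A x by exists p.
set U := u tau \o psi c.
have Gs := g_sym c x Ax.
have Gu : g tau c x \in unitmx by apply: posdef_unitmx => v; exact: g_pos.
(* Space-time regularity of order 2 yields the spatial derivatives of [U] up to order 2 from
   directions [(0, v)], and the time derivative from [(1, 0)]. *)
have [_ dH] := u_smooth c 2.
have sp y : A y -> spacetime_cod c (tau, y) by [].
have dU y v : A y ->
    is_derive y v U ('D_((0 : R), v) (fun z => u z.1 (psi c z.2)) (tau, y)).
  move=> Ay; apply: (@is_derive_slicer _ _ _ _ (fun z => u z.1 (psi c z.2))).
  by apply: derivableP; exact: (dH _).1 (sp _ Ay).
have A_open : open A by exact: cod_open.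
have ddU y i j : A y -> derivable (partial j U) y (delta_mx 0 i).
  move=> Ay; have [_ [_ /(_ ((0 : R), delta_mx 0 i))[ddH _]]] :=
    dH ((0 : R), delta_mx 0 j).
  have [dd _] := is_derive_slicer (derivableP (ddH _ (sp _ Ay))).
  apply: near_eq_derivable dd.
  have : \near y, A y by exact: open_nbhs_nbhs.
  by apply: filterS => z Az; have [_ <-] := dU z (delta_mx 0 j) Az.
have U_gt0 y : A y -> 0 < U y by move=> _; exact: u_gt0.
have lap a := @tr_hessian_cstB_ln _ _ (g tau c) A U A_open U_gt0
  (fun y i Ay => @ex_derive _ _ _ _ _ _ _ (dU y _ Ay)) ddU a x Gu Gs Ax.
(* The logarithm of the normalising factor, constant in space at fixed [tau]. *)
pose a := ln ((4 * pi * tau) `^ (- (n%:R / 2))).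
have fE : f tau \o psi c = fun y => a - ln (U y).
  apply/funext => y /=; rewrite /U /= f_def // lnM ?posrE ?expR_gt0 //; last first.
    by rewrite powR_gt0 // !mulr_gt0 ?pi_gt0.
  by rewrite expRK opprD opprK addNKr.
have sol := g_soliton tau p c tau0 cp.
(* Tracing the soliton equation with the inverse metric turns its right-hand side into [n] over
   [2 * tau]. *)
have := congr1 (fun B => \tr (invmx (g tau c x) *m B)) sol => /=.
rewrite fE mulmxDr mxtraceD lap -scalemxAr mulVmx // mxtraceZ mxtrace1.
rewrite -/(scalar_curvature _ _) => trE.
have psiK : psi c x = p by exact: phiK.
have du : is_derive tau 1 (fun s => u s p)
    ('D_(1, 0) (fun z => u z.1 (psi c z.2)) (tau, x)).
  (* Writing [p] as [psi c x] exhibits the function of [s] as a slice of the coordinate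
     expression. *)
  rewrite -[in fun s => _]psiK.
  apply: (@is_derive_slicel _ _ _ _ (fun z => u z.1 (psi c z.2))).
  by apply: derivableP; exact: (dH _).1 (sp _ Ax).
have u0 := u_gt0 tau p tau0.
have [_ dln] := is_derive_ln_comp u0 du.
have [_ duE] := du.
rewrite derive1E dln -duE -derive1E (u_che tau p c tau0 cp).
(* Both sides are now the scalar curvature plus the squared gradient norm minus [laplacian] of [U]
   over [U], once the factor [u tau p] cancels against its inverse. *)
rewrite [RHS]mulrC -trE -/x -/U {1 3}/U /= psiK mulrBr mulrCA mulVf ?gt_eqF //.
by rewrite mulr1 opprB addrCA.
Qed.
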